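(* Let $N$ be a nonempty, bounded, closed and convex subset of $\mathbf{L}^2(\Omega)=(L^2(\Omega))^3$. Then the convex functional $J:\mathbf{L}^2(\Omega)\to\mathbb{R}$, $J(\mathbf{u})=\frac12\Vert\mathcal{M}(\mathbf{u})-\mathbf{U}^0\Vert^2_{\mathbf{L}^2(\Omega),S}$, has a minimum on $N$; that is, there exists $\mathbf{u}^*\in N$ such that $J(\mathbf{u}^* )\le J(\mathbf{v})$ for all $\mathbf{v}\in N$.
   Context: $\Omega\subset\mathbb{R}^3$ is a Lipschitz domain. All functions are real valued. The observation operator $\mathcal{M}:(L^2(\Omega))^3\to(L^2(\Omega))^2$ is $\mathcal{M}(u_1,u_2,u_3)=(u_1,u_2)$. The field $\mathbf{U}^0\in(L^2(\Omega))^2$ is given. $S$ is a (constant, real) symmetric positive definite $2\times2$ matrix, and for $\mathbf{U},\mathbf{V}\in(L^2(\Omega))^2$ one sets $\langle\mathbf{U},\mathbf{V}\rangle_{\mathbf{L}^2(\Omega),S}=\int_\Omega (S\mathbf{U})\cdot\mathbf{V}\,dx$ and $\Vert\mathbf{U}\Vert^2_{\mathbf{L}^2(\Omega),S}=\langle\mathbf{U},\mathbf{U}\rangle_{\mathbf{L}^2(\Omega),S}$. *)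

(* Defs.v *)
From HB Require Import structures.
From mathcomp Require Import all_boot all_order all_algebra.
From mathcomp Require Import all_classical all_reals all_analysis.
From mathcomp Require Import measurable_realfun ess_sup_inf.

Set Implicit Arguments.
Unset Strict Implicit.
Unset Printing Implicit Defensive.
Import Order.TTheory GRing.Theory Num.Theory.
Import numFieldNormedType.Exports.

Local Open Scope classical_set_scope.
Local Open Scope ring_scope.

(* MathComp-Analysis defines the quotient L^p space [LspaceType] of classes of
   almost everywhere equal functions, but gives it no algebraic or topological
   structure.  This section makes it a normed module for the usual operations
   on classes and the L^p norm. *)
Section Lspace_normed.
Context d (T : measurableType d) (R : realType).
Variables (mu : {measure set T -> \bar R}) (p : \bar R) (p1 : (1 <= p)%E).
Local Notation Lf := (LfunType mu p1).
Local Notation Ls := (LspaceType mu p1).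
Local Notation cls := {mfun_ mu, T >-> measurableTypeR R}.

Lemma ae_eq_Lnorm (f g : T -> R) : measurable_fun setT f ->
  measurable_fun setT g -> f = g %[ae mu] ->
  ('N[mu]_p[EFin \o f] = 'N[mu]_p[EFin \o g])%E.
Proof.
move=> mf mg fg; rewrite unlock /Lnorm; case: p p1 => [r r1|_|//].
- congr (_ `^ _)%E; apply: ae_eq_integral => //=.
  + apply/measurable_EFinP.
    apply/(@measurableT_comp _ _ _ _ _ _ (fun x : R => x `^ r)%R) => //.
    exact/measurableT_comp.
  + apply/measurable_EFinP.
    apply/(@measurableT_comp _ _ _ _ _ _ (fun x : R => x `^ r)%R) => //.
    exact/measurableT_comp.
  + by move: fg; apply: filterS => x /= /[apply] ->.
- case: ifPn => // _; apply: eq_ess_sup.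
  by move: fg; apply: filterS => x /= /(_ I) ->.
Qed.

Lemma Lspace_inj (u v : Ls) : (u : cls) = v -> u = v.
Proof.
case: u v => [u [[cu]]] [v [[cv]]] /= uv; subst v.
by rewrite (Prop_irrelevance cu cv).
Qed.

Lemma Lrep_subproof (u : Ls) : (u : T -> R) \in Lfun mu p.
Proof.
apply/andP; split; rewrite inE/=.
  have := @measurable_funPT _ _ _ _ (repr (u : cls)); exact.
exact: Lebesgue_finite.
Qed.

Definition Lrep (u : Ls) : Lf := Lfun_Sub p1 (Lrep_subproof u).

Lemma mfun_of_Lfun_subproof (f : Lf) :
  @measurable_fun _ _ T (measurableTypeR R) setT f.
Proof. exact: (@measurable_funPT _ _ _ _ f). Qed.

Definition mfun_of_Lfun (f : Lf) : {mfun T >-> measurableTypeR R} :=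
  HB.pack_for {mfun T >-> measurableTypeR R} (f : T -> measurableTypeR R)
    (isMeasurableFun.Build _ _ T (measurableTypeR R) f
      (mfun_of_Lfun_subproof f)).

Definition Lcls_quot (f : Lf) : cls := (\pi_cls (mfun_of_Lfun f))%qT.

Lemma Lcls_quotE (f : Lf) : (Lcls_quot f : T -> R) = f %[ae mu].
Proof.
have : repr (Lcls_quot f) = mfun_of_Lfun f %[mod cls]%qT by rewrite reprK.
by move=> /eqP; rewrite eqmodE => /asboolP.
Qed.

Lemma Lcls_subproof (f : Lf) : finite_norm mu p (Lcls_quot f).
Proof.
rewrite /finite_norm (ae_eq_Lnorm _ _ (Lcls_quotE f)) //.
- exact: (@Lfunction_finite _ _ _ _ _ p1 f).
- exact: (@measurable_funPT _ _ _ _ (repr (Lcls_quot f))).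
Qed.

Definition Lcls (f : Lf) : Ls :=
  HB.pack_for Ls (Lcls_quot f)
    (isFinLebesgue.Build _ _ _ mu p p1 (Lcls_quot f) (Lcls_subproof f)).

Lemma LclsK (f : Lf) : Lrep (Lcls f) = f %[ae mu].
Proof. exact: Lcls_quotE. Qed.

Lemma Lcls_eq (f g : Lf) : f = g %[ae mu] -> Lcls f = Lcls g.
Proof.
move=> fg; apply: Lspace_inj => /=; apply/eqP.
by rewrite /Lcls_quot eqmodE; apply/asboolP.
Qed.

Lemma LrepK (u : Ls) : Lcls (Lrep u) = u.
Proof.
apply: Lspace_inj => /=; rewrite -[RHS]reprK; apply/eqP.
by rewrite /Lcls_quot eqmodE; apply/asboolP; apply: nearW.
Qed.

Lemma LrepE (u v : Ls) : Lrep u = Lrep v %[ae mu] -> u = v.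
Proof. by move=> uv; rewrite -(LrepK u) -(LrepK v); exact: Lcls_eq. Qed.

HB.instance Definition _ := gen_eqMixin Ls.
HB.instance Definition _ := gen_choiceMixin Ls.

Definition Lspace_zero : Ls := Lcls 0.
Definition Lspace_opp (u : Ls) : Ls := Lcls (- Lrep u).
Definition Lspace_add (u v : Ls) : Ls := Lcls (Lrep u + Lrep v).
Definition Lspace_scale (a : R) (u : Ls) : Ls := Lcls (a *: Lrep u).
Definition Lspace_norm (u : Ls) : R := fine 'N[mu]_p[EFin \o Lrep u]%E.

Lemma Lcls0 : Lrep Lspace_zero = (fun=> 0) %[ae mu].
Proof. exact: LclsK. Qed.
Lemma LclsN u : Lrep (Lspace_opp u) = (fun x => - Lrep u x) %[ae mu].
Proof. exact: LclsK. Qed.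
Lemma LclsD u v : Lrep (Lspace_add u v) = (fun x => Lrep u x + Lrep v x) %[ae mu].
Proof. exact: LclsK. Qed.
Lemma LclsZ a u : Lrep (Lspace_scale a u) = (fun x => a * Lrep u x) %[ae mu].
Proof. exact: LclsK. Qed.

Lemma Lspace_addA : associative Lspace_add.
Proof.
move=> u v w; apply: LrepE.
near=> x => _; rewrite (near (LclsD u (Lspace_add v w)) x) //.
by rewrite (near (LclsD (Lspace_add u v) w) x) // (near (LclsD u v) x) //
  (near (LclsD v w) x) // addrA.
Unshelve. all: by end_near. Qed.

Lemma Lspace_addC : commutative Lspace_add.
Proof.
move=> u v; apply: LrepE.
near=> x => _; rewrite (near (LclsD u v) x) // (near (LclsD v u) x) //.
by rewrite addrC.
Unshelve. all: by end_near. Qed.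

Lemma Lspace_add0 : left_id Lspace_zero Lspace_add.
Proof.
move=> u; apply: LrepE.
near=> x => _; rewrite (near (LclsD Lspace_zero u) x) // (near Lcls0 x) //.
by rewrite add0r.
Unshelve. all: by end_near. Qed.

Lemma Lspace_addN : left_inverse Lspace_zero Lspace_opp Lspace_add.
Proof.
move=> u; apply: LrepE.
near=> x => _; rewrite (near (LclsD (Lspace_opp u) u) x) //.
by rewrite (near (LclsN u) x) // (near Lcls0 x) // addNr.
Unshelve. all: by end_near. Qed.

HB.instance Definition _ := GRing.isZmodule.Build Ls
  Lspace_addA Lspace_addC Lspace_add0 Lspace_addN.

Lemma Lspace_scaleA a b u :
  Lspace_scale a (Lspace_scale b u) = Lspace_scale (a * b) u.
Proof.
apply: LrepE; near=> x => _; rewrite (near (LclsZ a (Lspace_scale b u)) x) //.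
by rewrite (near (LclsZ b u) x) // (near (LclsZ (a * b) u) x) // mulrA.
Unshelve. all: by end_near. Qed.

Lemma Lspace_scale1 : left_id 1 Lspace_scale.
Proof.
move=> u; apply: LrepE; near=> x => _.
by rewrite (near (LclsZ 1 u) x) // mul1r.
Unshelve. all: by end_near. Qed.

Lemma Lspace_scaleDr : right_distributive Lspace_scale +%R.
Proof.
move=> a u v; apply: LrepE; near=> x => _.
rewrite (near (LclsZ a (u + v)) x) //.
rewrite (near (LclsD (Lspace_scale a u) (Lspace_scale a v)) x) //.
rewrite (near (LclsD u v) x) // (near (LclsZ a u) x) // (near (LclsZ a v) x) //.
by rewrite mulrDr.
Unshelve. all: by end_near. Qed.

Lemma Lspace_scaleDl u : {morph Lspace_scale^~ u : a b / a + b}.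
Proof.
move=> a b; apply: LrepE; near=> x => _.
rewrite (near (LclsD (Lspace_scale a u) (Lspace_scale b u)) x) //.
rewrite (near (LclsZ (a + b) u) x) // (near (LclsZ a u) x) //.
by rewrite (near (LclsZ b u) x) // mulrDl.
Unshelve. all: by end_near. Qed.

HB.instance Definition _ := GRing.Zmodule_isLmodule.Build R Ls
  Lspace_scaleA Lspace_scale1 Lspace_scaleDr Lspace_scaleDl.

Lemma Lnorm_Lcls (f : Lf) :
  'N[mu]_p[EFin \o Lrep (Lcls f)]%E = 'N[mu]_p[EFin \o f]%E.
Proof.
apply: ae_eq_Lnorm (LclsK f).
- exact: (@measurable_funPT _ _ _ _ (Lrep (Lcls f))).
- exact: (@measurable_funPT _ _ _ _ f).
Qed.

Lemma ler_Lspace_normD u v :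
  Lspace_norm (u + v) <= Lspace_norm u + Lspace_norm v.
Proof. by rewrite /Lspace_norm Lnorm_Lcls; exact: ler_LnormD. Qed.

Lemma Lspace_normZ a u : Lspace_norm (a *: u) = `|a| * Lspace_norm u.
Proof.
rewrite /Lspace_norm Lnorm_Lcls; apply: EFin_inj.
by rewrite finite_norm_fine LnormZ EFinM finite_norm_fine.
Qed.

Lemma Lspace_norm0_eq0 u : Lspace_norm u = 0 -> u = 0.
Proof.
move=> /fine_Lnormr_eq0 u0; apply: LrepE.
by near=> x => _; rewrite (near Lcls0 x) // (near u0 x).
Unshelve. all: by end_near. Qed.

HB.instance Definition _ := Lmodule_isNormed.Build R Ls
  ler_Lspace_normD Lspace_normZ Lspace_norm0_eq0.

End Lspace_normed.

Section space.
Context {R : realType}.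

(* R^3 as a measurable space; [measurableTypeR R] is R with its Borel sets, the
   domain of the library's Lebesgue measure. *)
Definition R3 : Type :=
  (measurableTypeR R * measurableTypeR R * measurableTypeR R)%type.
HB.instance Definition _ := Measurable.on R3.

(* Borel sets suffice: every Lebesgue measurable function is almost everywhere
   equal to a Borel one, so the spaces of classes are the same. *)
Definition lebesgue3 : {measure set R3 -> \bar R} :=
  (lebesgue_measure \x lebesgue_measure \x lebesgue_measure)%E.

Definition sqdist (x y : R * R * R) : R :=
  (x.1.1 - y.1.1) ^+ 2 + (x.1.2 - y.1.2) ^+ 2 + (x.2 - y.2) ^+ 2.

Definition rigid_motion (T : R * R * R -> R * R * R) :=
  forall x y, sqdist (T x) (T y) = sqdist x y.

(* Near each boundary point, and up to a rigid motion T, the domain is the part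
   of space lying above the graph of a Lipschitz function phi of the first two
   coordinates.  The domain is not assumed bounded. *)
Definition lipschitz_domain (Omega : set (R * R * R)) :=
  [/\ Omega !=set0, open Omega, connected Omega &
    forall a, (closure Omega `\` Omega^°) a ->
      exists T : R * R * R -> R * R * R, exists phi : R * R -> R,
        [/\ rigid_motion T, lipschitz phi &
          \forall x \near a, Omega x <-> phi (T x).1 < (T x).2]].

Lemma open_measurable_R3 (U : set (R * R * R)) :
  open U -> measurable (U : set R3).
Proof.
move=> oU.
pose B (q : rat) (n : nat) : set R := ball (ratr q : R) n.+1%:R^-1.
pose box (t : rat * rat * rat * nat) : set R3 :=
  (B t.1.1.1 t.2 `*` B t.1.1.2 t.2) `*` B t.1.2 t.2.
have mB q n : measurable (B q n : set (measurableTypeR R)).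
  exact: (measurable_ball (ratr q : R) n.+1%:R^-1).
have mbox t : measurable (box t).
  by apply: measurableX => //; apply: measurableX.
pose F (k : nat) : set R3 :=
  if unpickle k is Some t then if `[< box t `<=` U >] then box t else set0
  else set0.
have -> : U = \bigcup_k F k.
  apply/seteqP; split => [x Ux|x [k _]]; last first.
    by rewrite /F; case: (unpickle k) => [t|//]; case: asboolP => // + bx; exact.
  have /nbhs_ballP[e /= e0 xeU] : nbhs x U by exact: open_nbhs_nbhs.
  have [n ne] : exists n : nat, n.+1%:R^-1 < e / 2 :> R.
    exists (Num.truncn (e / 2)^-1).
    rewrite invf_plt ?posrE ?divr_gt0 //.
    by rewrite truncnS_gt.
  have rat_near (y : R) : exists q, B q n y.
    have n0 : 0 < n.+1%:R^-1 :> R by rewrite invr_gt0.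
    have /rat_in_itvoo[q] : y - n.+1%:R^-1 < y + n.+1%:R^-1.
      by rewrite ltrD2l (lt_trans _ n0) // oppr_lt0.
    rewrite in_itv /= => /andP[q1 q2]; exists q.
    by rewrite /B /ball /= ltr_distl; apply/andP; split.
  have [q1 Bq1] := rat_near x.1.1.
  have [q2 Bq2] := rat_near x.1.2.
  have [q3 Bq3] := rat_near x.2.
  have xb : box (q1, q2, q3, n) x by split; [split|].
  have bU : box (q1, q2, q3, n) `<=` U.
    have BB q (y z : R) : B q n y -> B q n z -> ball y e z.
      by move=> yB zB; apply: (@ball_splitr _ _ (ratr q : R));
        apply: (le_ball (ltW ne)).
    move=> z [[/= z1 z2] z3]; apply: xeU.
    by split; [split; [apply: BB z1|apply: BB z2]|apply: BB z3].
  have [k Fk] : exists k, F k = box (q1, q2, q3, n).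
    by exists (pickle (q1, q2, q3, n)); rewrite /F pickleK asboolT.
  by exists k => //; rewrite Fk.
apply: bigcupT_measurable => k; rewrite /F; case: (unpickle k) => [t|//].
by case: asboolP.
Qed.

End space.
Arguments R3 : clear implicits.

Section observation.
Context {R : realType} {Omega : set (R * R * R)}.
Variable hOmega : lipschitz_domain Omega.

Lemma lipschitz_domain_measurable : measurable (Omega : set (R3 R)).
Proof. by case: hOmega => _ oO _ _; exact: open_measurable_R3. Qed.

(* Lebesgue measure restricted to Omega; L^2(Omega) is L^2 for this measure. *)
Definition dx : {measure set (R3 R) -> \bar R} :=
  mrestr lebesgue3 lipschitz_domain_measurable.

Definition L2 : normedModType R := LspaceType2 dx.

(* The product norm is the maximum of the norms of the components; it is
   equivalent to the Euclidean norm of L^2(Omega)^3. *)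
Definition L2_3 : normedModType R := (L2 * L2 * L2)%type.
Definition L2_2 : normedModType R := (L2 * L2)%type.

Definition observe (u : L2_3) : L2_2 := (u.1.1, u.1.2).

Definition L2_val (f : L2) : R3 R -> R := (f : LspaceType2 dx).

(* The value at x of a representative of the pair of classes U. *)
Definition field2 (U : L2_2) (x : R3 R) : 'cV[R]_2 :=
  \col_(i < 2) (if i == 0 then L2_val U.1 x else L2_val U.2 x).

Definition dotS (S : 'M[R]_2) (U V : L2_2) : R :=
  \int[dx]_x ((S *m field2 U x)^T *m field2 V x) 0 0.

Definition J (S : 'M[R]_2) (U0 : L2_2) (u : L2_3) : R :=
  2^-1 * dotS S (observe u - U0) (observe u - U0).

End observation.

Definition sym_posdef (R : realType) n (S : 'M[R]_n) :=
  S^T = S /\ forall x : 'cV[R]_n, x != 0 -> 0 < (x^T *m S *m x) 0 0.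

(* Main.v *)
Require Import Defs.
From mathcomp Require Import all_boot all_order all_algebra.
From mathcomp Require Import all_classical all_reals all_analysis.
From mathcomp Require Import measurable_realfun.
From mathcomp Require Import ring lra.
Import Order.TTheory GRing.Theory Num.Theory.
Import numFieldNormedType.Exports.
Local Open Scope classical_set_scope.
Local Open Scope ring_scope.

(** The functional J is convex and continuous but not coercive: it ignores the
    third component of its argument, so minimizing sequences need not converge
    and some form of weak compactness of N is required.  It is obtained here
    without weak topologies.

    The key fact is that a decreasing sequence of nonempty bounded closed convex
    sets in a Hilbert space has a common point
    ([nested_bounded_closed_convex]).  If d n is the infimum of the squared norm
    over the n-th set, then d is nondecreasing and bounded, hence convergent,
    and by the parallelogram identity any choice of almost minimal elements is a
    Cauchy sequence; its limit lies in every set.  Applied to the sets of those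
    u in N with J u <= inf J + 1/(n+1), this yields a minimizer
    ([convex_minimum_attained]).

    The Hilbert space structure has to be supplied.  The parallelogram identity
    in L^2 comes from the bilinear form [ip]; completeness of L^2 is the
    Riesz-Fischer theorem ([L2_complete]).  The norm of L^2(Omega)^3 is a
    maximum and satisfies no parallelogram identity, so the argument above is
    run with the equivalent form [sqr_norm3].  Finally, 2 J(u) is the value at
    M(u) - U0 of a nonnegative quadratic form, itself a linear combination of
    values of [ip]; hence convexity, by a polynomial identity
    ([dotS_quadratic_identity]), and continuity, by polarization ([cvg_ip]). *)

(** * Minimization over bounded closed convex sets *)

(** Completeness for Cauchy sequences given with an explicit modulus r; in this
    form it passes to products componentwise, with the same modulus. *)
Definition modulus_complete (R : realType) (V : normedModType R) :=
  forall (u : nat -> V) (r : nat -> R), r n @[n --> \oo] --> 0 ->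
    (forall n m, (n <= m)%N -> `|u n - u m| <= r n) ->
    exists l : V, u n @[n --> \oo] --> l.

Arguments modulus_complete {R} V.

Lemma modulus_complete_prod (R : realType) (V W : normedModType R) :
  modulus_complete V -> modulus_complete W ->
  modulus_complete (V * W)%type.
Proof.
move=> cV cW u r r0 ur.
have [|l1 ul1] := cV (fun n => (u n).1) r r0.
  move=> n m nm.
  by apply: le_trans (ur n m nm); rewrite [leRHS]prod_normE le_max lexx.
have [|l2 ul2] := cW (fun n => (u n).2) r r0.
  move=> n m nm.
  by apply: le_trans (ur n m nm); rewrite [leRHS]prod_normE le_max lexx orbT.
exists (l1, l2).
have -> : u = (fun n => ((u n).1, (u n).2)) by apply/funext => n; case: (u n).
exact: cvg_pair.
Qed.

(* In this section the square root of Q plays the role of a Hilbert norm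
   equivalent to the given norm of V. *)
Section parallelogram_form.
Context (R : realType) (V : normedModType R) (Q : V -> R) (c : R).
Hypothesis V_complete : modulus_complete V.
Hypothesis sqr_norm_le : forall x, `|x| ^+ 2 <= Q x.
Hypothesis c_ge0 : 0 <= c.
Hypothesis le_sqr_norm : forall x, Q x <= c * `|x| ^+ 2.
Hypothesis parallelogram : forall x y,
  Q (x - y) = 2 * Q x + 2 * Q y - 4 * Q (2^-1 *: (x + y)).

(** A substitute for weak compactness: almost minimal elements of the sets C n
    for Q form a Cauchy sequence, since the midpoint of two of them cannot have
    a much smaller Q. *)
Lemma nested_bounded_closed_convex (C : nat -> set V) :
  (forall n, C n !=set0) -> (forall n, closed (C n)) ->
  (forall n x y, C n x -> C n y -> C n (2^-1 *: (x + y))) ->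
  (forall n m, (n <= m)%N -> C m `<=` C n) -> bounded_set (C 0%N) ->
  \bigcap_n C n !=set0.
Proof.
move=> Cne Ccl Cmid Cdec C0b; have [x0 Cx0] := Cne 0%N.
have [B CB] := (@ex_bound _ _ _ _ _ (globally_properfilter Cx0)).1 C0b.
have Q0 x : 0 <= Q x by apply: le_trans (sqr_norm_le x); exact: exprn_ge0.
pose d n := inf (Q @` C n).
have d_le n x : C n x -> d n <= Q x.
  by move=> Cnx; apply: ge_inf; [exists 0 => _ [y _ <-]|exists x].
have CQ n : has_inf (Q @` C n).
  split; last by exists 0 => _ [y _ <-].
  by have [x Cx] := Cne n; exists (Q x), x.
have d_nd : nondecreasing_seq d.
  move=> n m nm; apply: lb_le_inf; first by case: (CQ m).
  by move=> _ [x Cx <-]; apply: d_le; exact: Cdec Cx.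
have Bd n : d n <= c * B ^+ 2.
  have [x Cx] := Cne n; apply: le_trans (d_le _ _ Cx) _.
  apply: le_trans (le_sqr_norm x) _.
  have C0x : C 0%N x by exact: Cdec Cx.
  have xB : `|x| <= B := CB _ C0x.
  rewrite ler_wpM2l// lerXn2r ?nnegrE//; exact: le_trans xB.
have d_cvg : cvgn d.
  by apply: nondecreasing_is_cvgn => //; exists (c * B ^+ 2) => _ [n _ <-].
have /choice[u uP] n : exists x, C n x /\ Q x < d n + n.+1%:R^-1.
  have [|_ [x Cx <-] xd] := inf_adherent _ (CQ n) (eps := n.+1%:R^-1).
    by rewrite invr_gt0.
  by exists x.
(* For n <= m the midpoint of u n and u m lies in C n, so its Q is at least
   d n; the parallelogram identity then bounds Q (u n - u m) by e n. *)
pose e n := 2 * (limn d - d n) + 4 * n.+1%:R^-1.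
have e0 : e n @[n --> \oo] --> 0.
  have -> : 0 = 2 * (limn d - limn d) + 4 * 0 :> R by rewrite subrr !mulr0 addr0.
  apply: cvgD; apply: cvgMr; last exact: cvg_harmonic.
  by apply: cvgB => //; exact: cvg_cst.
have ue n m : (n <= m)%N -> `|u n - u m| <= Num.sqrt (e n).
  move=> nm; rewrite -[leLHS]ger0_norm// -sqrtr_sqr ler_wsqrtr//.
  apply: le_trans (sqr_norm_le _) _; rewrite parallelogram.
  have [Cn un] := uP n; have [Cm um] := uP m.
  have := d_le _ _ (Cmid _ _ _ Cn (Cdec _ _ nm _ Cm)).
  have : d m <= limn d by exact: nondecreasing_cvgn_le.
  have : m.+1%:R^-1 <= n.+1%:R^-1 :> R by rewrite lef_pV2 ?posrE// ler_nat.
  move: un um; rewrite /e; move: (n.+1%:R^-1) (m.+1%:R^-1) => en em; lra.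
have [||l ul] := V_complete u (fun n => Num.sqrt (e n)) => //.
  rewrite -sqrtr0; apply: continuous_cvg => //; exact: sqrt_continuous.
exists l => n _; apply: (closed_cvg (C n)) ul => //.
by exists n => // m /= nm; apply: (Cdec _ _ nm); case: (uP m).
Qed.

(** The minimizers form the intersection of the sublevel sets at heights
    inf J + 1/(n+1), which are nested, closed and convex. *)
Theorem convex_minimum_attained (J : V -> R) (N : set V) :
  N !=set0 -> bounded_set N -> closed N -> convex_set N ->
  has_lbound (J @` N) -> continuous J -> convex_function setT J ->
  exists2 u, N u & forall v, N v -> J u <= J v.
Proof.
move=> [x0 Nx0] Nb Ncl Ncv Jlb Jct Jcv.
have half_ge0 : 0 <= 2^-1 :> R by lra.
have half_le1 : 2^-1 <= 1 :> R by lra.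
pose half : {i01 R} := Itv01 half_ge0 half_le1.
pose C n := N `&` [set x | J x <= inf (J @` N) + n.+1%:R^-1].
have NJ : has_inf (J @` N).
  by split; first by exists (J x0), x0.
have [| | | | |u Cu] := @nested_bounded_closed_convex C.
- move=> n; have [|_ [x Cx <-] xd] := inf_adherent _ NJ (eps := n.+1%:R^-1).
    by rewrite invr_gt0.
  by exists x; split => //=; exact: ltW.
- move=> n; apply: closedI => //.
  by apply: (preimage_closed _ (@closed_le _ _)) => x _; exact: Jct.
- move=> n x y [Nx Jx] [Ny Jy].
  have -> : 2^-1 *: (x + y) = 2^-1 *: x + (1 - 2^-1) *: y.
    by rewrite scalerDr; congr (_ + _ *: _); lra.
  split; first by have /set_mem := Ncv x y half (mem_set Nx) (mem_set Ny).
  apply: (le_trans (Jcv half x y (mem_set I) (mem_set I))).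
  have -> : conv half (J x : R^o) (J y : R^o) = 2^-1 * J x + (1 - 2^-1) * J y by [].
  move: Jx Jy => /=; move: (n.+1%:R^-1) => e; lra.
- move=> n m nm x [Nx Jx]; split => //=; apply: le_trans Jx _.
  by rewrite lerD2l lef_pV2 ?posrE// ler_nat.
- by apply: sub_boundedr Nb => A; apply: subset_trans => x [].
exists u; first by have [] := Cu 0%N I.
move=> v Nv; apply: (@le_trans _ _ (inf (J @` N))); last first.
  by apply: ge_inf => //; exists v.
apply/ler_addgt0Pr => e e0.
have [n ne] : exists n : nat, n.+1%:R^-1 < e.
  exists (Num.truncn e^-1).
  by rewrite invf_plt ?posrE// truncnS_gt.
have [_ /le_trans] := Cu n I; apply.
by rewrite lerD2l ltW.
Qed.
End parallelogram_form.

(** * The Hilbert space of square integrable functions *)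

Section L2_inner_product.
Context d (T : measurableType d) (R : realType).
Variable mu : {measure set T -> \bar R}.
Local Notation L2 := (LspaceType2 mu).
Implicit Types u v w : L2.

Definition ip u v : R := \int[mu]_x (u x * v x).

Lemma ip_integrable u v : mu.-integrable setT (EFin \o (fun x => u x * v x)).
Proof.
by apply/Lfun1_integrable; apply: Lfun2_mul_Lfun1; exact: Lrep_subproof.
Qed.

Lemma measurable_L2 u : measurable_fun setT (u : T -> R).
Proof. exact: (@measurable_funPT _ _ _ _ (Lrep u)). Qed.

Lemma ipC u v : ip u v = ip v u.
Proof. by apply: eq_Rintegral => x _; rewrite mulrC. Qed.

Lemma ip_linearl a u v w : ip (a *: u + v) w = a * ip u w + ip v w.
Proof.
rewrite /ip -RintegralZl//; last exact: ip_integrable.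
have iau : mu.-integrable setT (EFin \o (fun x => a * (u x * w x))).
  exact: integrableZl (ip_integrable u w).
rewrite -RintegralD//; last exact: ip_integrable.
congr fine; apply: ae_eq_integral => //.
- by apply/measurable_EFinP/measurable_funM; exact: measurable_L2.
- apply: (measurable_int mu); exact: integrableD iau (ip_integrable v w).
near=> x => _; congr EFin.
have /= -> // := near (LclsD (a *: u) v) x.
have /= -> // := near (LclsZ a u) x.
by rewrite mulrDl mulrA.
Unshelve. all: by end_near.
Qed.

Lemma sqr_normE_integral u : (`|u| ^+ 2)%:E = (\int[mu]_x (u x ^+ 2)%:E)%E.
Proof.
have -> : `|u| = fine ('N[mu]_2%:E[EFin \o u])%E by [].
rewrite EFin_expe (finite_norm_fine (Lrep u)) unlock.
have int0 : (0 <= \int[mu]_x `|(EFin \o Lrep u) x| `^ 2)%E.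
  by apply: integral_ge0 => x _; exact: poweR_ge0.
rewrite poweR12_sqrt// sqr_sqrte//; apply: eq_integral => x _ /=.
by rewrite powR_mulrn// real_normK// num_real.
Qed.


Lemma sqr_normE u : `|u| ^+ 2 = ip u u.
Proof.
rewrite -[LHS]/(fine (_ ^+ 2)%:E) sqr_normE_integral.
by congr fine; apply: eq_integral => x _; rewrite expr2.
Qed.

Lemma sqr_normB_integral u v :
  (`|u - v| ^+ 2)%:E = (\int[mu]_x ((u x - v x) ^+ 2)%:E)%E.
Proof.
rewrite sqr_normE_integral; apply: ae_eq_integral => //.
- by apply/measurable_EFinP/measurable_funX; exact: measurable_L2.
- by apply/measurable_EFinP/measurable_funX/measurable_funB; exact: measurable_L2.
near=> x => _; congr ((_ ^+ 2)%:E).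
have /= -> // := near (LclsD u (- v)) x.
by have /= -> // := near (LclsN v) x.
Unshelve. all: by end_near.
Qed.

(** With D k the k-th increment, the integral of the sum of 4^k (D k)^2 is at
    most the sum of the 4^-k; so this sum is finite almost everywhere, and there
    D k x is bounded by a multiple of 2^-k, hence summable. *)
Lemma L2_ae_cvg (s : nat -> L2) :
  (forall n m, (n <= m)%N -> `|s n - s m| <= 4^-1 ^+ n) ->
  \forall x \ae mu, cvgn (fun n => s n x).
Proof.
move=> sfast.
pose D k x : R := s k.+1 x - s k x.
have mD k : measurable_fun setT (D k).
  by apply: measurable_funB; exact: measurable_L2.
have D0 k x : (0 <= (4 ^+ k * D k x ^+ 2)%:E)%E.
  by rewrite lee_fin; apply: mulr_ge0; [exact: exprn_ge0|exact: sqr_ge0].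
have mD2 k : measurable_fun setT (fun x => (4 ^+ k * D k x ^+ 2)%:E).
  by apply/measurable_EFinP/measurable_funM => //; exact: measurable_funX.
pose H x : \bar R := (\sum_(0 <= k <oo) (4 ^+ k * D k x ^+ 2)%:E)%E.
have H0 x : (0 <= H x)%E by exact: nneseries_ge0.
have iH : mu.-integrable setT H.
  apply/integrableP; split; first exact: ge0_emeasurable_sum.
  under eq_integral do rewrite gee0_abs//.
  rewrite integral_nneseries//.
  apply: (@le_lt_trans _ _ (\sum_(0 <= k <oo) (4^-1 ^+ k)%:E)%E).
    apply: lee_nneseries => [k _ _|k _]; first exact: integral_ge0.
    under eq_integral do rewrite EFinM.
    rewrite ge0_integralZl_EFin//; last 2 first.
    - by move=> x _; rewrite lee_fin sqr_ge0.
    - by apply/measurable_EFinP; exact: measurable_funX.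
    rewrite -sqr_normB_integral -EFinM lee_fin distrC.
    have h : `|s k - s k.+1| ^+ 2 <= (4^-1 ^+ k) ^+ 2.
      by rewrite lerXn2r ?nnegrE ?exprn_ge0// sfast.
    apply: (le_trans (ler_wpM2l _ h)); first exact: exprn_ge0.
    by rewrite expr2 mulrA -exprMn divff// expr1n mul1r.
  apply: (@le_lt_trans _ _ (1 / (1 - 4^-1))%:E); last exact: ltry.
  apply: lime_le.
    by apply: is_cvg_nneseries => k _ _; rewrite lee_fin exprn_ge0.
  near=> n; rewrite sumEFin lee_fin.
  have := @geometric_le_lim R n 1 4^-1 ler01.
  rewrite /series/=; under eq_bigr do rewrite mul1r.
  apply; first by lra.
  by rewrite ger0_norm; lra.
near=> x.
have Hfin : H x \is a fin_num by exact: (near (integrable_ae measurableT iH) x).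
pose M := fine (H x).
have DM k : `|D k x| <= Num.sqrt M * 2^-1 ^+ k.
  have : ((4 ^+ k * D k x ^+ 2)%:E <= H x)%E.
    apply: le_trans (nneseries_lim_ge k.+1 (fun i _ _ => D0 i x)).
    by rewrite big_nat_recr//= leeDr// sume_ge0.
  rewrite -(fineK Hfin) lee_fin -/M => DkM.
  have -> : 2^-1 ^+ k = Num.sqrt (4^-1 ^+ k) :> R.
    rewrite -[LHS]ger0_norm ?exprn_ge0// -sqrtr_sqr exprAC.
    by congr (Num.sqrt (_ ^+ k)); rewrite expr2 -invfM -natrM.
  rewrite -sqrtr_sqr -sqrtrM ?fine_ge0// ler_wsqrtr//.
  by rewrite exprVn ler_pdivlMr ?exprn_gt0// mulrC.
have : cvgn (series (fun k => D k x)).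
  apply: normed_cvg.
  apply: (@series_le_cvg _ _ (geometric (Num.sqrt M) 2^-1)) => //.
  - by move=> k /=.
  - by move=> k; rewrite /= mulr_ge0// ?sqrtr_ge0 ?exprn_ge0.
  - by apply: is_cvg_geometric_series; rewrite ger0_norm; lra.
have -> : (fun k => D k x) = telescope (fun n => s n x) by [].
rewrite telescopeK => h.
have -> : (fun n => s n x) = (fun n => (s n x - s 0%N x) + s 0%N x).
  by apply/funext => n; rewrite subrK.
by apply: is_cvgD => //; exact: is_cvg_cst.
Unshelve. all: by end_near.
Qed.

Lemma cvg_sqr_sub (a l : R) (y : R^nat) : y n @[n --> \oo] --> l ->
  ((a - y n) ^+ 2)%:E @[n --> \oo] --> ((a - l) ^+ 2)%:E.
Proof.
move=> yl; have ayl : a - y n @[n --> \oo] --> a - l.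
  by apply: cvgB => //; exact: cvg_cst.
apply: cvg_EFin; first exact: nearW.
by under eq_fun do rewrite /= expr2; rewrite expr2; exact: cvgM.
Qed.

(** The limit is the almost everywhere pointwise limit f of the
    representatives; Fatou's lemma applied to (s n - s m)^2 as m grows transfers
    the bound on s n - s m to s n - f, which also shows that f is square
    integrable. *)
Lemma L2_cvg_of_modulus (s : nat -> L2) :
  (forall n m, (n <= m)%N -> `|s n - s m| <= 4^-1 ^+ n) ->
  exists l : L2, forall n, `|s n - l| <= 4^-1 ^+ n.
Proof.
move=> sfast.
(* An upper limit is measurable, and it is the limit wherever that exists. *)
pose f x : R := fine (limn_esup (fun n => (s n x)%:E)).
have mf : measurable_fun setT f.
  apply: (measurableT_comp (fine_measurable measurableT)).
  apply: measurable_fun_limn_esup => n.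
  by apply/measurable_EFinP; exact: measurable_L2.
have sf : \forall x \ae mu, s n x @[n --> \oo] --> f x.
  near=> x; have sx : cvgn (fun n => s n x) by exact: (near (L2_ae_cvg _ sfast) x).
  have [l /= sl] := (cvg_ex _).1 sx.
  suff -> : f x = l by [].
  have : (s n x)%:E @[n --> \oo] --> l%:E by apply: cvg_EFin => //; exact: nearW.
  by rewrite /f => /cvg_limn_einf_sup[_ ->].
have fatou_bound n : (\int[mu]_x ((s n x - f x) ^+ 2)%:E <= ((4^-1 ^+ n) ^+ 2)%:E)%E.
  have mg m : measurable_fun setT (fun x => ((s n x - s m x) ^+ 2)%:E).
    by apply/measurable_EFinP/measurable_funX/measurable_funB; exact: measurable_L2.
  have -> : (\int[mu]_x ((s n x - f x) ^+ 2)%:E =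
      \int[mu]_x limn_einf (fun m => ((s n x - s m x) ^+ 2)%:E))%E.
    apply: ae_eq_integral => //.
    - apply/measurable_EFinP/measurable_funX/measurable_funB => //.
      exact: measurable_L2.
    - under eq_fun do rewrite -[limn_einf _]oppeK -limn_esupN.
      apply: measurableT_comp => //.
      by apply: measurable_fun_limn_esup => m; exact: measurableT_comp.
    near=> x => _.
    have sx : s m x @[m --> \oo] --> f x by exact: (near sf x).
    have : ((s n x - s m x) ^+ 2)%:E @[m --> \oo] --> ((s n x - f x) ^+ 2)%:E.
      exact: cvg_sqr_sub.
    by move=> /cvg_limn_einf_sup[-> _].
  apply: le_trans (fatou _ _ mg _) _ => //.
    by move=> m x _; rewrite lee_fin sqr_ge0.
  rewrite limn_einf_lim; apply: lime_le; first exact: is_cvg_einfs.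
  exists n => // m /= nm.
  apply: (@le_trans _ _ (\int[mu]_x ((s n x - s m x) ^+ 2)%:E)%E).
    by apply: ereal_inf_lbound; exists m => /=.
  by rewrite -sqr_normB_integral lee_fin lerXn2r ?nnegrE ?exprn_ge0// sfast.
have Lf : f \in Lfun mu 2%:E.
  have -> : f = (s 0%N : T -> R) - (fun x => s 0%N x - f x).
    by apply/funext => x; rewrite !fctE opprB addrC subrK.
  apply: rpredB => [|p1|p1]; first exact: lee1n.
    exact: Lrep_subproof.
  apply/andP; split; rewrite inE/=.
    by apply: measurable_funB => //; exact: measurable_L2.
  rewrite /finite_norm unlock poweR_lty//.
  apply: le_lt_trans (ltry _); apply: le_trans (fatou_bound 0%N).
  rewrite le_eqVlt; apply/orP; left; apply/eqP; apply: eq_integral => x _ /=.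
  by rewrite powR_mulrn// real_normK// num_real.
exists (Lcls (Lfun_Sub (lee1n 2) Lf)) => n.
rewrite -(@ler_pXn2r _ 2)// ?nnegrE ?exprn_ge0// -lee_fin sqr_normB_integral.
apply: le_trans (fatou_bound n).
rewrite le_eqVlt; apply/orP; left; apply/eqP; apply: ae_eq_integral => //.
- by apply/measurable_EFinP/measurable_funX/measurable_funB; exact: measurable_L2.
- apply/measurable_EFinP/measurable_funX/measurable_funB => //.
  exact: measurable_L2.
near=> x => _; congr ((_ ^+ 2)%:E).
by have /= -> // := near (LclsK (Lfun_Sub (lee1n 2) Lf)) x.
Unshelve. all: by end_near.
Qed.

(** Riesz-Fischer: a subsequence with modulus 4^-k converges by
    [L2_cvg_of_modulus], and the whole sequence follows it.  The extraction N
    need not be monotone. *)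
Lemma L2_complete : modulus_complete L2.
Proof.
move=> u r r0 ur.
have /choice[N rN] k : exists n, r n <= 4^-1 ^+ k.
  have : \forall n \near \oo, r n < 4^-1 ^+ k.
    by apply: (cvgr_lt 0 r0); rewrite exprn_gt0// invr_gt0.
  by case=> n _ /(_ n (leqnn n)) /ltW rn; exists n.
have uN k m : (N k <= m)%N -> `|u (N k) - u m| <= 4^-1 ^+ k.
  by move=> km; apply: le_trans (ur _ _ km) (rN k).
have [|l sl] := L2_cvg_of_modulus (u \o N).
  move=> n m nm /=; have [NN|/ltnW NN] := leqP (N n) (N m); first exact: uN.
  rewrite distrC; apply: le_trans (uN _ _ NN) _.
  by rewrite ler_wiXn2l//; lra.
exists l; apply/cvgrPdist_le => e e0.
have q1 : `|4^-1 : R| < 1 by rewrite ger0_norm; lra.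
have : \forall k \near \oo, (4^-1 : R) ^+ k < e / 2.
  by apply: (cvgr_lt 0 (cvg_expr q1)); rewrite divr_gt0.
case=> k _ /(_ k (leqnn k)) ke.
exists (N k) => // m /= km.
rewrite distrC -(subrK (u (N k)) (u m)) -addrA.
apply: le_trans (ler_normD _ _) _; rewrite distrC.
apply: le_trans (lerD (uN _ _ km) (sl k)) _.
move: ke => /=; lra.
Qed.

Lemma ipDl u v w : ip (u + v) w = ip u w + ip v w.
Proof. by rewrite -[u]scale1r ip_linearl mul1r scale1r. Qed.

Lemma ipZl a u w : ip (a *: u) w = a * ip u w.
Proof.
have := ip_linearl a u 0 w; rewrite addr0 => ->.
suff -> : ip 0 w = 0 by rewrite addr0.
by have := ip_linearl 1 0 0 w; rewrite scaler0 addr0; lra.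
Qed.

Lemma ipDr u v w : ip w (u + v) = ip w u + ip w v.
Proof. by rewrite ipC ipDl !(ipC w). Qed.

Lemma ipZr a u w : ip w (a *: u) = a * ip w u.
Proof. by rewrite ipC ipZl ipC. Qed.

Definition ipE := (ipDl, ipDr, ipZl, ipZr).

Lemma L2_parallelogram u v :
  `|u - v| ^+ 2 = 2 * `|u| ^+ 2 + 2 * `|v| ^+ 2 - 4 * `|2^-1 *: (u + v)| ^+ 2.
Proof. by rewrite !sqr_normE -(scaleN1r v) !ipE (ipC v u); field. Qed.

Lemma ip_polarization u v : ip u v = 4^-1 * (`|u + v| ^+ 2 - `|u - v| ^+ 2).
Proof. by rewrite !sqr_normE -(scaleN1r v) !ipE (ipC v u); field. Qed.

(** Polarization reduces joint continuity of [ip] to continuity of the norm. *)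
Lemma cvg_ip (I : Type) (F : set_system I) (FF : Filter F) (f g : I -> L2) u v :
  f i @[i --> F] --> u -> g i @[i --> F] --> v ->
  ip (f i) (g i) @[i --> F] --> ip u v.
Proof.
move=> fu gv; under eq_fun do rewrite ip_polarization !expr2.
rewrite ip_polarization !expr2; apply: cvgMr.
by apply: cvgB; apply: cvgM; apply: cvg_norm; do ?[exact: cvgD|exact: cvgB].
Qed.

End L2_inner_product.
Arguments ip {d T R mu} u v.

(** * The observation functional *)

Section functional.
Context (R : realType) (Omega : set (R * R * R)).
Variable hOmega : lipschitz_domain Omega.
Implicit Types (u v : L2_3 hOmega) (U V : L2_2 hOmega) (S : 'M[R]_2).

(** The squared Euclidean norm of L^2(Omega)^3, a Hilbert norm equivalent to the
    maximum norm. *)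
Definition sqr_norm3 u : R := `|u.1.1| ^+ 2 + `|u.1.2| ^+ 2 + `|u.2| ^+ 2.

Lemma sqr_norm3_ge u : `|u| ^+ 2 <= sqr_norm3 u.
Proof.
rewrite [`|u|]prod_normE [`|u.1|]prod_normE /sqr_norm3.
have := sqr_ge0 `|u.1.1|; have := sqr_ge0 `|u.1.2|; have := sqr_ge0 `|u.2|.
case: (leP `|u.1.1| `|u.1.2|) => _;
  [case: (leP `|u.1.2| `|u.2|) => _|case: (leP `|u.1.1| `|u.2|) => _]; lra.
Qed.

Lemma sqr_norm3_le u : sqr_norm3 u <= 3 * `|u| ^+ 2.
Proof.
have h1 : `|u.1| <= `|u| by rewrite [leRHS]prod_normE le_max lexx.
have h2 : `|u.2| <= `|u| by rewrite [leRHS]prod_normE le_max lexx orbT.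
have h11 : `|u.1.1| <= `|u|.
  by apply: le_trans h1; rewrite [leRHS]prod_normE le_max lexx.
have h12 : `|u.1.2| <= `|u|.
  by apply: le_trans h1; rewrite [leRHS]prod_normE le_max lexx orbT.
have sq (a b : R) : 0 <= a -> a <= b -> a ^+ 2 <= b ^+ 2.
  by move=> a0 ab; rewrite lerXn2r ?nnegrE// (le_trans a0).
have := sq _ _ (normr_ge0 _) h11; have := sq _ _ (normr_ge0 _) h12.
have := sq _ _ (normr_ge0 _) h2; rewrite /sqr_norm3; lra.
Qed.

Lemma sqr_norm3_parallelogram u v :
  sqr_norm3 (u - v) = 2 * sqr_norm3 u + 2 * sqr_norm3 v
    - 4 * sqr_norm3 (2^-1 *: (u + v)).
Proof.
rewrite /sqr_norm3 /=.
have := L2_parallelogram _ _ _ _ u.1.1 v.1.1.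
have := L2_parallelogram _ _ _ _ u.1.2 v.1.2.
have := L2_parallelogram _ _ _ _ u.2 v.2.
by move=> -> -> ->; ring.
Qed.

Lemma L2_3_complete : modulus_complete (L2_3 hOmega).
Proof.
apply: modulus_complete_prod; last exact: L2_complete.
by apply: modulus_complete_prod; exact: L2_complete.
Qed.

Lemma dotS_ip S U V : dotS S U V =
  S 0 0 * ip U.1 V.1 + S 0 1 * ip U.2 V.1 +
  S 1 0 * ip U.1 V.2 + S 1 1 * ip U.2 V.2.
Proof.
rewrite /ip -!RintegralZl//; try exact: ip_integrable.
have I a (f g : L2 hOmega) :
    (@dx _ _ hOmega).-integrable setT (EFin \o (fun x => a * (f x * g x))).
  exact: integrableZl (ip_integrable _ _ _ _ f g).
have ID (f g : R3 R -> R) : (@dx _ _ hOmega).-integrable setT (EFin \o f) ->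
    (@dx _ _ hOmega).-integrable setT (EFin \o g) ->
    (@dx _ _ hOmega).-integrable setT (EFin \o (fun x => f x + g x)).
  exact: integrableD.
rewrite -!RintegralD//; do ?[exact: I|apply: (ID (fun x => _) (fun x => _))].
apply: eq_Rintegral => x _.
have e0 : widen_ord (leqnSn 1) ord_max = 0 :> 'I_2 by exact/val_inj.
have e1 : ord_max = 1 :> 'I_2 by exact/val_inj.
rewrite !(mxE, big_ord_recr, big_ord0) /= e0 e1 !add0r /L2_val; ring.
Qed.

(** The identity behind the convexity of a quadratic form: the defect of
    convexity is t (1 - t) times the form at U - V. *)
Lemma dotS_quadratic_identity S U V (t : R) :
  dotS S (t *: U + (1 - t) *: V) (t *: U + (1 - t) *: V) =
  t * dotS S U U + (1 - t) * dotS S V V - t * (1 - t) * dotS S (U - V) (U - V).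
Proof.
rewrite !dotS_ip /= -(scaleN1r V.1) -(scaleN1r V.2) !ipE.
by ring.
Qed.

Lemma dotS_ge0 S U : sym_posdef S -> 0 <= dotS S U U.
Proof.
move=> [Ssym Spos]; apply: Rintegral_ge0 => x _.
rewrite trmx_mul Ssym.
have [->|/Spos/ltW//] := eqVneq (field2 U x) 0.
by rewrite mulmx0 mxE.
Qed.

Lemma observe_conv (t : R) u v (U0 : L2_2 hOmega) :
  observe (t *: u + (1 - t) *: v) - U0 =
  t *: (observe u - U0) + (1 - t) *: (observe v - U0).
Proof.
have -> : observe (t *: u + (1 - t) *: v) =
    t *: observe u + (1 - t) *: observe v by [].
by rewrite !scalerBr addrACA -opprD -scalerDl subrKC scale1r.
Qed.

Lemma J_convex S U0 :
  sym_posdef S -> convex_function setT (J (hOmega := hOmega) S U0).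
Proof.
move=> hS t u v _ _.
rewrite [leRHS](_ : _ = t%:num * J S U0 u + (1 - t%:num) * J S U0 v)//.
have -> : conv t (u : convex_lmodType _) v = t%:num *: u + (1 - t%:num) *: v by [].
rewrite /J observe_conv dotS_quadratic_identity.
have := dotS_ge0 S ((observe u - U0) - (observe v - U0)) hS.
have t0' : 0 <= t%:num by [].
have t1' : t%:num <= 1 by [].
rewrite /=.
set q := dotS _ (_ - _ - _) _ => q0.
have : 0 <= t%:num * (1 - t%:num) * q by rewrite !mulr_ge0// subr_ge0.
lra.
Qed.

Lemma J_continuous S U0 : continuous (J (hOmega := hOmega) S U0).
Proof.
move=> u; rewrite /J; apply: cvgMr.
under eq_fun do rewrite dotS_ip.
rewrite dotS_ip /=.
have cst : (fun v : L2_3 hOmega => v.1) @ u --> u.1 by exact: cvg_fst.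
have c1 : v.1.1 - U0.1 @[v --> u] --> u.1.1 - U0.1.
  apply: cvgB; last exact: cvg_cst.
  by apply: (cvg_comp _ _ cst); exact: cvg_fst.
have c2 : v.1.2 - U0.2 @[v --> u] --> u.1.2 - U0.2.
  apply: cvgB; last exact: cvg_cst.
  by apply: (cvg_comp _ _ cst); exact: cvg_snd.
by apply: cvgD; [apply: cvgD; [apply: cvgD|]|]; apply: cvgMr; exact: cvg_ip.
Qed.

End functional.

Theorem mainTheorem1 (R : realType) (Omega : set (R * R * R))
    (hOmega : lipschitz_domain Omega)
    (S : 'M[R]_2) (hS : sym_posdef S) (U0 : L2_2 hOmega)
    (N : set (L2_3 hOmega)) :
  N !=set0 -> bounded_set N -> closed N -> convex_set N ->
  convex_function setT (J S U0) /\
  exists2 u : L2_3 hOmega, N u & forall v, N v -> J S U0 u <= J S U0 v.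
Proof.
move=> N0 Nb Ncl Ncv; split; first exact: J_convex.
apply: (@convex_minimum_attained _ _ (@sqr_norm3 _ _ hOmega) 3) => //.
- exact: L2_3_complete.
- exact: sqr_norm3_ge.
- exact: sqr_norm3_le.
- exact: sqr_norm3_parallelogram.
- by exists 0 => _ [u _ <-]; rewrite mulr_ge0// ?dotS_ge0.
- exact: J_continuous.
- exact: J_convex.
Qed.
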